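(* Let $\mathbb{F}_q$ be a finite field of characteristic $2$ and let $\mathcal{F}=\mathbb{F}_q(x,y)$ be a cubic function field given in standard form by $y^3-Ay+B=0$ with $A,B\in\mathbb{F}_q[x]$. Assume that $B$ is cubefree and that every finite place $P$ of $\mathbb{F}_q(x)$ with $3v_P(A)<2v_P(B)$ has $P$-signature $(1,1,2,1)$. Set $I=\mathrm{ind}(y)$ and $G=\gcd(I,A)$. Let $U,V,W\in\mathbb{F}_q[x]$ satisfy $$U^2\equiv A \pmod{(I/G)^2},\qquad U\equiv 0\pmod G,\qquad V\equiv 0\pmod I.$$ Then $\{1,\;y+W,\;(y^2+Uy+V)/I\}$ is an integral basis of $\mathcal{F}/\mathbb{F}_q(x)$.
   Context: Cubic function field in standard form: $\mathcal{F}=\mathbb{F}_q(x,y)$ where $x$ is transcendental over $\mathbb{F}_q$, $T^3-A(x)T+B(x)\in\mathbb{F}_q[x][T]$ is irreducible over $\mathbb{F}_q(x)$ with root $y$, at least one of $A,B$ is non-constant, there is no non-constant $Q\in\mathbb{F}_q[x]$ with $Q^2\mid A$ and $Q^3\mid B$, and $\mathbb{F}_q$ is algebraically closed in $\mathcal{F}$. Finite places of $\mathbb{F}_q(x)$ are identified with monic irreducible polynomials $P\in\mathbb{F}_q[x]$, with valuation $v_P$ ($v_P(0)=\infty$). $P$-signature $(1,1,2,1)$ means: there are exactly two places of $\mathcal{F}$ above $P$, one with ramification index and relative degree both $1$, the other with ramification index $2$ and relative degree $1$. $\mathcal{O}$ is the integral closure of $\mathbb{F}_q[x]$ in $\mathcal{F}$;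 an integral basis of $\mathcal{F}/\mathbb{F}_q(x)$ is an $\mathbb{F}_q[x]$-basis of $\mathcal{O}$. $\Delta=\mathrm{disc}(\mathcal{F})$ is the discriminant of an integral basis (well defined up to squares in $\mathbb{F}_q^*$), $D=\mathrm{disc}(1,y,y^2)=4A^3-27B^2=B^2$, and the index $I=\mathrm{ind}(y)\in\mathbb{F}_q[x]$ is defined, up to a constant factor, by $D=I^2\Delta$. *)

(* Defs.v *)
From HB Require Import structures.
From mathcomp Require Import all_boot all_order all_algebra all_field.
From mathcomp Require Import constructive_ereal.

Set Implicit Arguments.
Unset Strict Implicit.
Unset Printing Implicit Defensive.

Import Order.TTheory GRing.Theory Num.Theory.
Local Open Scope ring_scope.

(* F_q is a finFieldType K, F_q[x] is {poly K}, F_q(x) is {fraction {poly K}},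
   and a function field over F_q is a finite extension L of F_q(x).           *)

Section PolyValuation.

Variable K : finFieldType.

(* Intended for a non-constant P, for which P ^+ i %| a and a != 0 force
   i < size a, so that the maximum is the exact exponent of P in a.           *)
Definition vP (P a : {poly K}) : \bar int :=
  if a == 0 then +oo%E else (Posz (\max_(i < size a | P ^+ i %| a) i))%:E.

Definition finite_place (P : {poly K}) : Prop :=
  P \is monic /\ irreducible_poly P.

Definition cubefree (B : {poly K}) : Prop :=
  forall Q : {poly K}, Q ^+ 3 %| B -> (size Q <= 1)%N.

End PolyValuation.

Section FunctionField.

Variables (K : finFieldType) (L : fieldExtType {fraction {poly K}}).

Definition polyL (p : {poly K}) : L := (FracField.tofrac p)%:A.

Definition constL (c : K) : L := polyL c%:P.

(* Places of L are represented by their normalized discrete valuations; two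
   places are equal when their valuations agree pointwise.  The value -oo is
   excluded by the axioms.                                                    *)
Record is_place (v : L -> \bar int) : Prop := IsPlace {
  place_eq_oo : forall z, v z = +oo%E <-> z = 0;
  placeM : forall z w, v (z * w) = (v z + v w)%E;
  placeD : forall z w, (Order.min (v z) (v w) <= v (z + w)%R)%E;
  place_normalized : exists z, v z = 1%:E;
  place_const : forall c : K, c != 0 -> v (constL c) = 0%:E
}.

Definition lies_above (v : L -> \bar int) (P : {poly K}) : Prop :=
  (0%:E < v (polyL P))%E.

Definition ramification_index (v : L -> \bar int) (P : {poly K}) (e : nat) :
  Prop := (0 < e)%N /\ forall a, v (polyL a) = ((Posz e)%:E * vP P a)%E.

(* The residue field of v has dimension f over the residue field of the
   restriction of v to F_q(x): b is a family of representatives in the valuation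
   ring of v whose residue classes form a basis.                              *)
Definition relative_degree (v : L -> \bar int) (f : nat) : Prop :=
  exists b : 'I_f -> L,
  [/\ forall i, (0%:E <= v (b i))%E,
      forall z, (0%:E <= v z)%E ->
        exists2 c : 'I_f -> {fraction {poly K}},
          forall i, (0%:E <= v ((c i)%:A : L))%E &
          (0%:E < v (z - \sum_(i < f) c i *: b i)%R)%E &
      forall c : 'I_f -> {fraction {poly K}},
        (forall i, (0%:E <= v ((c i)%:A : L))%E) ->
        (0%:E < v (\sum_(i < f) c i *: b i)%R)%E ->
        forall i, (0%:E < v ((c i)%:A : L))%E].

(* The signature (e_1, f_1, e_2, f_2, ...) is written as the sequence of pairs
   [:: (e_1, f_1); (e_2, f_2); ...], one for each place above P.              *)
Definition has_signature (P : {poly K}) (s : seq (nat * nat)) : Prop :=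
  exists v : 'I_(size s) -> L -> \bar int,
  [/\ forall i, [/\ is_place (v i), lies_above (v i) P,
                    ramification_index (v i) P (nth (0, 0)%N s i).1 &
                    relative_degree (v i) (nth (0, 0)%N s i).2],
      forall i j, v i =1 v j -> i = j &
      forall w, is_place w -> lies_above w P -> exists i, w =1 v i].

Definition integral_basis (n : nat) (b : n.-tuple L) : Prop :=
  [/\ forall i, integralOver polyL (tnth b i),
      forall z, integralOver polyL z ->
        exists c : 'I_n -> {poly K}, z = \sum_(i < n) polyL (c i) * tnth b i &
      forall c : 'I_n -> {poly K},
        \sum_(i < n) polyL (c i) * tnth b i = 0 -> forall i, c i = 0].

Definition trL (z : L) : {fraction {poly K}} :=
  \tr (passmx.mxof (vbasis {:L}) (vbasis {:L}) (amulr z)).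

Definition disc (n : nat) (b : n.-tuple L) : {fraction {poly K}} :=
  \det (\matrix_(i < n, j < n) trL (tnth b i * tnth b j)).

(* The discriminant of L and the index of y are only defined up to squares of
   constants and up to constants respectively, hence the relations.           *)
Definition is_field_disc (Delta : {fraction {poly K}}) : Prop :=
  exists2 b : (\dim {:L}).-tuple L, integral_basis b & Delta = disc b.

Definition is_index (y : L) (I : {poly K}) : Prop :=
  exists2 Delta, is_field_disc Delta &
    disc [tuple 1; y; y ^+ 2] = FracField.tofrac I ^+ 2 * Delta.

Record standard_form (A B : {poly K}) (y : L) : Prop := StandardForm {
  std_irreducible : irreducible_poly
    ('X^3 - (FracField.tofrac A)%:P * 'X + (FracField.tofrac B)%:P);
  std_root : y ^+ 3 - polyL A * y + polyL B = 0;
  std_generator : <<1; y>>%VS = {:L}%VS;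
  std_nonconstant : (1 < size A)%N \/ (1 < size B)%N;
  std_minimal : forall Q : {poly K},
    Q ^+ 2 %| A -> Q ^+ 3 %| B -> (size Q <= 1)%N;
  std_constants : forall z : L, algebraicOver constL z ->
    exists c : K, z = constL c
}.

End FunctionField.

(* Main.v *)
Require Import Defs.
From HB Require Import structures.
From mathcomp Require Import all_boot all_order all_algebra all_field.
From mathcomp Require Import constructive_ereal ring zify.

Set Implicit Arguments.
Unset Strict Implicit.
Unset Printing Implicit Defensive.

Import Order.TTheory GRing.Theory Num.Theory.
Local Open Scope ring_scope.

(** Write [O] for the integral closure of [K[x]] in [L].  In characteristic 2
    the trace of [c0 + c1 y + c2 y^2] is [c0], so [1, y, y^2] has discriminant
    [B^2], and [B^2 = I^2 Delta] says that [Delta = J^2] with [B = I J].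

    The module spanned by the proposed basis has index [I] over the one spanned
    by [1, y, y^2], hence its discriminant is [(B / I)^2 = Delta].  An integral
    family whose discriminant is that of an integral basis is itself an integral
    basis ([integral_basis_disc]), so it is enough that [(y^2 + U y) / I] is
    integral.  This element is a root of [T^3 + q2 T + q3], where
    [I^2 q2 = A (U^2 - A) + U B] and [I^3 q3 = B (U (U^2 - A) + B)], which leaves
    two divisibilities in [K[x]].  They follow from the congruences on [U] once
    every prime dividing [B] is known to divide [J] ([prime_dvd_cofactor]):
    since [B] is cubefree, [I] is then squarefree, [I^2] divides [B], and [G] is
    coprime to [I / G] ([charpoly_coef_dvd]).

    So the heart of the matter is that every prime [P] of [B] divides [Delta].
    If [P] does not divide [Delta], the trace form is nondegenerate modulo [P],
    and [tr (u^2) = (tr u)^2] forces [O / P O] to be reduced ([reduced_of_disc]).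
    Two things then go wrong.
    - If [P] divides [A], then [y] is nilpotent modulo [P], so [y = P w] with [w]
      integral, and [B = tr (y^3) = P^3 tr (w^3)] is not cubefree.
    - Otherwise the signature provides a place of ramification index 2.  But
      [O / P O] is finite and reduced, so each of its elements is fixed by a power
      of Frobenius: [z - z^(2^d)] lies in [P O].  Comparing valuations, an element
      of [O] whose valuation is not a multiple of the ramification index yields
      another one of smaller valuation, an infinite descent.  Hence places above [P] are
      unramified ([reduced_unramified]). *)

(** * The trace form of a finite extension *)

Section FieldTrace.

Variables (F : fieldType) (L : fieldExtType F).

(** The trace of the extension; over [{fraction {poly K}}] this is [trL]. *)
Definition ftrace (z : L) : F :=
  \tr (passmx.mxof (vbasis {:L}) (vbasis {:L}) (amulr z)).

Lemma ftrace_is_linear : scalar ftrace.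
Proof.
move=> a u v; rewrite /ftrace.
have -> : amulr (a *: u + v) = a *: amulr u + amulr v by rewrite linearP.
by rewrite passmx.mxof_linear mxtraceD mxtraceZ.
Qed.

HB.instance Definition _ := GRing.isSemilinear.Build F L F *%R ftrace
  (GRing.semilinear_linear ftrace_is_linear).

Lemma ftraceD u v : ftrace (u + v) = ftrace u + ftrace v.
Proof. exact: raddfD. Qed.

Lemma ftraceZ a u : ftrace (a *: u) = a * ftrace u.
Proof. exact: (linearZ_LR (ftrace : {scalar L})). Qed.

(** The trace of an endomorphism is the same in all bases, which frees the
    computations from the arbitrary basis [vbasis {:L}]. *)
Lemma ftraceE n (e : n.-tuple L) z : basis_of {:L} e ->
  ftrace z = \sum_i coord e i (z * e`_i).
Proof.
move=> eb; have dn := size_basis eb; subst n.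
have vb := vbasisP {:L}; rewrite /ftrace.
have {1}-> : amulr z = (\1 \o (amulr z \o \1))%VF.
  by apply/lfunP=> u; rewrite !(comp_lfunE, lfunE).
rewrite (passmx.mxof_comp _ _ eb) (passmx.mxof_comp _ _ eb).
rewrite mxtrace_mulC mulmxA -(passmx.mxof_comp _ _ vb).
have -> : (\1 \o \1)%VF = (\1)%VF :> 'End(L).
  by apply/lfunP=> u; rewrite !(comp_lfunE, lfunE).
rewrite passmx.mxof1 ?(basis_free eb) // mul1mx; apply: eq_bigr => i _.
by rewrite !mxE passmx.vecof_delta !lfunE /= mulrC.
Qed.

(** Over [{fraction {poly K}}] this is [disc]. *)
Definition fdisc n (b : n.-tuple L) : F :=
  \det (\matrix_(i < n, j < n) ftrace (tnth b i * tnth b j)).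

Lemma fdisc_change n (u t : n.-tuple L) (C : 'M[F]_n) :
    (forall j, tnth t j = \sum_i C i j *: tnth u i) ->
  fdisc t = \det C ^+ 2 * fdisc u.
Proof.
move=> tE; rewrite expr2 mulrAC -{1}det_tr /fdisc -!det_mulmx.
congr (\det _); apply/matrixP=> i j; rewrite !mxE !tE mulr_sumr raddf_sum /=.
apply: eq_bigr => k _; rewrite mxE !mulr_suml raddf_sum /=.
apply: eq_bigr => l _; rewrite !mxE -scalerAl -scalerAr !ftraceZ.
by rewrite mulrA mulrAC.
Qed.

End FieldTrace.

(** * Traces in a cubic extension of characteristic 2 *)

Section CubicTrace.

Variables (F : fieldType) (L : fieldExtType F) (y : L) (a b : F).
Hypothesis char2 : 2%N \in [pchar F].
Hypothesis y3 : y ^+ 3 = a *: y + b *: 1.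

Local Notation e := [tuple 1; y; y ^+ 2].
Hypothesis eb : basis_of {:L} e.

Let y4 : y ^+ 4 = a *: y ^+ 2 + b *: y.
Proof. by rewrite (exprS y 3) y3 mulrDr -!scalerAr mulr1 expr2. Qed.

Lemma coord_power (i j : 'I_3) : coord e i (y ^+ j) = (i == j)%:R.
Proof.
have := coord_free j i (basis_free eb).
have -> : e`_j = y ^+ j by case: j => [[|[|[|]]]].
by move=> ->; rewrite eq_sym.
Qed.

(** In general these traces are 3, 0 and [2 a]. *)
Lemma ftrace_power :
  [/\ ftrace (1 : L) = 1, ftrace y = 0 & ftrace (y ^+ 2) = 0].
Proof.
have c0 i : coord e i 1 = (val i == 0)%:R.
  by rewrite -[1](expr0 y) (coord_power i 0).
have c1 i : coord e i y = (val i == 1)%:R.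
  by rewrite -{1}[y]expr1 (coord_power i 1).
have c2 i : coord e i (y ^+ 2) = (val i == 2)%:R by rewrite (coord_power i 2).
split; rewrite (ftraceE _ eb) !big_ord_recl big_ord0 /=
  ?mul1r ?mulr1 -?exprSr -?exprD -?expr2.
- by rewrite c0 c1 c2 /= addr0 (addrr_pchar2 char2) addr0.
- rewrite c1 c2 -exprS y3 !linearD !linearZ /= c0 c1 /= /GRing.scale /=.
  by rewrite !(mulr0, addr0).
- rewrite c2 /= y3 y4 !linearD !linearZ /= c0 !c1 c2 /= /GRing.scale /=.
  by rewrite !(mulr0, mulr1, addr0, add0r) (addrr_pchar2 char2).
Qed.

(** The sum of the squares of the conjugates is the square of their sum.  Here it
    is read off coordinates: squaring [c0 + c1 y + c2 y^2] gives [c0^2] plus a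
    combination of [y] and [y^2], both of trace zero. *)
Lemma ftrace_sqr (z : L) : ftrace (z ^+ 2) = ftrace z ^+ 2.
Proof.
have [t1 ty ty2] := ftrace_power.
have trE c0 c1 c2 : ftrace (c0 *: (1 : L) + c1 *: y + c2 *: y ^+ 2) = c0.
  by rewrite !ftraceD !ftraceZ t1 ty ty2 !mulr0 !addr0 mulr1.
have charL : 2%N \in [pchar L] by rewrite pchar_lalg.
have sqrD (u v : L) : (u + v) ^+ 2 = u ^+ 2 + v ^+ 2.
  exact: (pFrobenius_autD_comm charL (mulrC u v)).
rewrite (coord_basis eb (memvf z)) !big_ord_recl big_ord0 /= addr0 addrA trE.
set c0 := coord e _ z; set c1 := coord e _ z; set c2 := coord e _ z.
rewrite !sqrD !exprZn -exprM y4 expr1n scalerDr !scalerA.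
apply: etrans (trE (c0 ^+ 2) (c2 ^+ 2 * b) (c1 ^+ 2 + c2 ^+ 2 * a)).
by congr (ftrace _); rewrite scalerDl -!addrA; congr (_ + _);
   rewrite [RHS]addrC -addrA.
Qed.

Lemma fdisc_power : fdisc e = b ^+ 2.
Proof.
have [t1 ty ty2] := ftrace_power.
have ty3 : ftrace (y ^+ 3) = b.
  by rewrite y3 ftraceD !ftraceZ t1 ty mulr0 mulr1 add0r.
have ty4 : ftrace (y ^+ 4) = 0.
  by rewrite y4 ftraceD !ftraceZ ty ty2 !mulr0 addr0.
have -> : fdisc e = \det (\matrix_(i < 3, j < 3) ftrace (y ^+ (i + j))).
  congr (\det _); apply/matrixP=> i j; rewrite !mxE exprD.
  by case: i j => [[|[|[|]]] ?] // [[|[|[|]]] ?].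
do 2!rewrite !(expand_det_row _ ord0) !big_ord_recl !big_ord0 /cofactor.
rewrite !det_mx11 !mxE /bump /= !(addn0, add0n, addn1).
rewrite expr0 expr1 t1 ty ty2 ty3 ty4.
rewrite !(mul0r, mulr0, addr0, add0r, mul1r).
by rewrite mulN1r mulrN -expr2 (oppr_pchar2 char2).
Qed.

End CubicTrace.

(** * Integral elements *)

Section Integral.

Variables (K : finFieldType) (L : fieldExtType {fraction {poly K}}).

HB.instance Definition _ :=
  GRing.RMorphism.copy (@polyL K L) (in_alg L \o @FracField.tofrac {poly K}).

Local Notation phi := (polyL L).
Local Notation O := (integralOver phi).

Lemma polyL_scale p (z : L) : FracField.tofrac p *: z = phi p * z.
Proof. by rewrite /polyL mulr_algl. Qed.

Lemma polyL_eq0 p : (phi p == 0) = (p == 0).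
Proof. by rewrite /polyL scaler_eq0 oner_eq0 orbF tofrac_eq0. Qed.

Lemma frac_numden (a : {fraction {poly K}}) :
  exists2 nd : {poly K} * {poly K}, nd.2 != 0 &
    a = FracField.tofrac nd.1 / FracField.tofrac nd.2.
Proof.
elim/quotW: a => r; exists (\n_r, \d_r) => /=; first exact: denom_ratioP.
apply: (canRL (mulfK _)); first by rewrite tofrac_eq0 denom_ratioP.
unlock FracField.tofrac; rewrite -[LHS]FracField.pi_mul; apply/eqmodP => /=.
rewrite FracField.equivfE /FracField.mulf.
rewrite !numden_Ratio ?(oner_neq0, mulf_neq0, denom_ratioP) //.
by rewrite !mulr1 mulrC.
Qed.

Lemma integral_sum (I : finType) (f : I -> L) :
  (forall i, O (f i)) -> O (\sum_i f i).
Proof.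
move=> fO; apply: big_ind => // [|u v]; first exact: integral0.
exact: integral_add.
Qed.

Lemma integral_exp z k : O z -> O (z ^+ k).
Proof.
move=> zO; elim: k => [|k IH]; first exact: integral1.
by rewrite exprS; apply: integral_mul.
Qed.

Lemma integral_basis_basis n (e b : n.-tuple L) :
  basis_of {:L} e -> (forall i, O (tnth e i)) -> integral_basis b ->
  basis_of {:L} b.
Proof.
move=> eb eO [bO bspan _].
rewrite basisEdim size_tuple (size_basis eb) leqnn andbT.
rewrite -(span_basis eb); apply/span_subvP => u /tnthP[i ->].
have [c ->] := bspan _ (eO i); apply: memv_suml => j _.
by rewrite -polyL_scale memvZ // memv_span // mem_tnth.
Qed.

Lemma clear_denominators n (e : n.-tuple L) z :
  basis_of {:L} e -> (forall i, O (tnth e i)) ->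
  exists2 d, d != 0 & O (phi d * z).
Proof.
move=> eb eO; rewrite (coord_basis eb (memvf z)).
have: forall i, exists nd : {poly K} * {poly K}, nd.2 != 0 /\
    coord e i z = FracField.tofrac nd.1 / FracField.tofrac nd.2.
  by move=> i; have [nd ? ?] := frac_numden (coord e i z); exists nd.
case/fin_all_exists=> nd ndP.
exists (\prod_i (nd i).2).
  by apply/prodf_neq0 => i _; case: (ndP i).
rewrite mulr_sumr; apply: integral_sum => i; have [di0 ->] := ndP i.
set q := \prod_(j | j != i) (nd j).2.
have -> : \prod_j (nd j).2 = (nd i).2 * q by rewrite (bigD1 i).
rewrite -polyL_scale scalerA tofracM [_ / _]mulrC mulrACA.
rewrite divff ?tofrac_eq0 // mul1r.
rewrite -tofracM polyL_scale -tnth_nth; apply: integral_mul => //.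
exact: integral_id.
Qed.

(** Modulo [P], the ring of integral elements has no nilpotents. *)
Definition reduced_at (P : {poly K}) := forall z w : L,
  O z -> O w -> z ^+ 2 = phi P * w -> exists2 w', O w' & z = phi P * w'.

Section WithBasis.

Variables (n : nat) (b : n.-tuple L).
Hypothesis bI : integral_basis b.
Hypothesis bb : basis_of {:L} b.

(** Multiplication by [z] has a matrix with polynomial entries in the integral
    basis [b]. *)
Lemma trace_integral z : O z -> exists p, ftrace z = FracField.tofrac p.
Proof.
move=> zO; case: (bI) => bO bspan _; rewrite (ftraceE _ bb).
have : forall i, exists p, coord b i (z * b`_i) = FracField.tofrac p.
  move=> i; rewrite -tnth_nth; have [c ->] := bspan _ (integral_mul zO (bO i)).
  exists (c i); under eq_bigr do rewrite -polyL_scale (tnth_nth 0).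
  by rewrite coord_sum_free ?(basis_free bb).
case/fin_all_exists=> p pE; exists (\sum_i p i).
rewrite rmorph_sum; apply: eq_bigr => i _; exact: pE.
Qed.

Lemma disc_integral (t : n.-tuple L) : (forall i, O (tnth t i)) ->
  exists T : 'M[{poly K}]_n,
    (forall i j, ftrace (tnth t i * tnth t j) = FracField.tofrac (T i j)) /\
    fdisc t = FracField.tofrac (\det T).
Proof.
move=> tO; have tr i j := trace_integral (integral_mul (tO i) (tO j)).
have [T TE] := fin_all_exists (fun i => fin_all_exists (tr i)).
exists (\matrix_(i, j) T i j); split=> [i j|]; first by rewrite mxE TE.
rewrite -det_map_mx; congr (\det _); apply/matrixP=> i j.
by rewrite !mxE TE.
Qed.

(** If [z^2] is in [P O] then [tr (z b_j)^2 = tr (z^2 b_j^2)] is divisible by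
    [P], hence so is [tr (z b_j)], for every [j]: modulo [P] the coordinates of
    [z] are in the kernel of the trace form, whose determinant is [D]. *)
Lemma reduced_of_disc (P : {poly K}) D :
    (forall u : L, ftrace (u ^+ 2) = ftrace u ^+ 2) ->
    irreducible_poly P -> fdisc b = FracField.tofrac D -> ~~ (P %| D) ->
  reduced_at P.
Proof.
move=> tr2 irrP bD PD z w zO wO z2; case: (bI) => bO bspan _.
have [T [TE]] := disc_integral bO.
rewrite bD => /eqP; rewrite tofrac_eq => /eqP DT.
have [c zE] := bspan _ zO.
have dv j : P %| \sum_i c i * T i j.
  have [s sE] := trace_integral (integral_mul wO (integral_exp 2 (bO j))).
  have: (\sum_i c i * T i j) ^+ 2 = P * s.
    apply/eqP; rewrite -tofrac_eq; apply/eqP; rewrite tofracXn tofracM -sE.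
    rewrite -ftraceZ polyL_scale mulrA -z2 -exprMn tr2; congr (_ ^+ 2).
    rewrite zE mulr_suml !raddf_sum; apply: eq_bigr => i _ /=.
    by rewrite tofracM -TE -ftraceZ polyL_scale mulrA.
  move=> sq; have: P %| (\sum_i c i * T i j) ^+ 2 by rewrite sq dvdp_mulr.
  rewrite expr2; apply: contraLR => Pn.
  by rewrite Gauss_dvdpr ?irreducible_poly_coprime.
have dvc i : P %| c i.
  suff: P %| c i * D by rewrite Gauss_dvdpl ?irreducible_poly_coprime.
  have : \row_i c i *m T *m \adj T = D *: \row_i c i.
    by rewrite -mulmxA mul_mx_adj DT -scalemx1 -scalemxAr mulmx1.
  move/rowP/(_ i); rewrite !mxE mulrC => <-.
  apply: (big_ind (fun x => P %| x)) => [|u v|j _].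
  - exact: dvdp0.
  - exact: dvdp_add.
  by rewrite mxE dvdp_mulr //; under eq_bigr do rewrite mxE.
exists (\sum_i phi (c i %/ P) * tnth b i).
  by apply: integral_sum => i; apply: integral_mul => //; apply: integral_id.
rewrite zE mulr_sumr; apply: eq_bigr => i _.
by rewrite mulrA -rmorphM [P * _]mulrC divpK.
Qed.

End WithBasis.
End Integral.

(** * Frobenius modulo a polynomial *)

Section Frobenius.

Variables (K : finFieldType) (L : fieldExtType {fraction {poly K}}).
Local Notation phi := (polyL L).
Local Notation O := (integralOver phi).

(** Pigeonhole: [O / P O] is finite. *)
Lemma frobenius_repeats n (b : n.-tuple L) P (z : L) :
  integral_basis b -> P != 0 -> O z ->
  exists i d w, [/\ (0 < d)%N, O w &
    z ^+ (2 ^ i) - z ^+ (2 ^ (i + d)) = phi P * w].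
Proof.
move=> [bO bspan _] P0 zO.
(* T stands for O / P O: coordinates in the basis b, reduced modulo P. *)
pose T : finType := {ffun 'I_n -> 'rV[K]_(size P)}.
have: forall k : 'I_#|T|.+1, exists c : 'I_n -> {poly K},
    z ^+ (2 ^ k) = \sum_i phi (c i) * tnth b i.
  by move=> k; apply: bspan; apply: integral_exp.
case/fin_all_exists=> c cE.
pose g (k : 'I_#|T|.+1) : T := [ffun i => poly_rV (c k i %% P)].
have /injectivePn[k [l nkl gkl]] : ~~ injectiveb g.
  by apply/negP => /injectiveP/leq_card; rewrite card_ord ltnn.
wlog lt_kl : k l nkl gkl / (k < l)%N.
  move=> IH; case: (ltngtP k l) => [|ltlk|eqkl]; first exact: IH.
  - by apply: (IH l k) => //; rewrite eq_sym.
  - by case/eqP: nkl; apply: val_inj.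
exists k, (l - k)%N, (\sum_i phi ((c k i - c l i) %/ P) * tnth b i).
rewrite subn_gt0 lt_kl subnKC 1?ltnW //; split=> //.
  by apply: integral_sum => i; apply: integral_mul => //; apply: integral_id.
rewrite !cE mulr_sumr -sumrB; apply: eq_bigr => i _.
have dvd : P %| c k i - c l i.
  rewrite /dvdp modpD modpN.
  have /ffunP/(_ i) := gkl; rewrite !ffunE => /(congr1 rVpoly).
  rewrite !poly_rV_K -1?ltnS ?(leq_trans (ltn_modpN0 _ P0)) // => ->.
  by rewrite subrr.
by rewrite mulrA -rmorphM [P * _]mulrC divpK // rmorphB mulrBl.
Qed.

(** A repetition [z^(2^i) = z^(2^(i+d))] modulo [P] reads
    [(z - z^(2^d))^(2^i) = 0], and there are no nilpotents. *)
Lemma reduced_frobenius n (b : n.-tuple L) P (z : L) :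
  2%N \in [pchar K] -> integral_basis b -> P != 0 -> reduced_at L P -> O z ->
  exists d w, [/\ (0 < d)%N, O w & z - z ^+ (2 ^ d) = phi P * w].
Proof.
move=> char2 bI P0 red zO.
have [i [d [w [d0 wO]]]] := frobenius_repeats bI P0 zO.
have charL : 2%N \in [pchar L].
  by apply: (rmorph_pchar phi); apply: (rmorph_pchar (@polyC K)).
have subX k (u v : L) : u ^+ (2 ^ k) - v ^+ (2 ^ k) = (u - v) ^+ (2 ^ k).
  elim: k u v => [|k IH] u v; first by rewrite !expr1.
  by rewrite !expnS !exprM IH -(pFrobenius_autB_comm charL (mulrC u v)).
rewrite addnC expnD exprM subX => zw; exists d.
suff [w' w'O ?] : exists2 w', O w' & z - z ^+ (2 ^ d) = phi P * w'.
  by exists w'.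
have : O (z - z ^+ (2 ^ d)).
  by apply: integral_sub => //; apply: integral_exp.
elim: i (z - _) w wO zw => [|i IH] u w wO uw uO.
  by exists w; rewrite // -uw expr1.
have u2O : O (u ^+ (2 ^ i)) by apply: integral_exp.
by have [| w' w'O /IH] := red _ w u2O wO; [rewrite -exprM -expnSr | apply].
Qed.

End Frobenius.

(** * Places *)

Section Valuation.

Variables (K : finFieldType) (P : {poly K}).

Lemma vP_eq0 a : a != 0 -> ~~ (P %| a) -> vP P a = 0%:E.
Proof.
move=> a0 Pa; rewrite /vP (negPf a0); congr (Posz _)%:E.
apply: big1 => i Pi; apply/eqP; rewrite -leqn0 leqNgt; apply: contra Pa => i0.
by apply: dvdp_trans Pi; rewrite dvdp_exp.
Qed.

Lemma vP_gt0 a : finite_place P -> P %| a -> (0%:E < vP P a)%E.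
Proof.
move=> [_ [P1 _]] Pa; rewrite /vP; have [//|a0] := eqVneq a 0.
have a1 : (1 < size a)%N by apply: leq_trans P1 (dvdp_leq a0 Pa).
rewrite lte_fin ltz_nat.
exact: (@leq_bigmax_cond _ _ (fun i : 'I_(size a) => val i) (Ordinal a1)).
Qed.

End Valuation.

Section Places.
Local Open Scope ereal_scope.

Variables (K : finFieldType) (L : fieldExtType {fraction {poly K}}).
Local Notation phi := (polyL L).
Local Notation O := (integralOver phi).

Variable v : L -> \bar int.
Hypothesis v_place : is_place v.
Hypothesis v_ge0 : forall a : {poly K}, 0%:E <= v (phi a).

Lemma place1 : v 1 = 0%:E.
Proof.
by rewrite -(place_const v_place (oner_neq0 K)) /constL polyC1 rmorph1.
Qed.

(** At an element with a pole, a monic polynomial with coefficients regular at [v]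
    cannot vanish: the leading term dominates. *)
Lemma place_monic_horner (z : L) (p : {poly {poly K}}) :
  v z < 0%:E -> p \is monic -> v (map_poly phi p).[z] <= 0%:E.
Proof.
move=> vz; elim/poly_ind: p => [|p c IH].
  by move=> /monicP; rewrite lead_coef0 => /eqP; rewrite eq_sym oner_eq0.
rewrite monicE; have [->|p0] := eqVneq p 0%R.
  rewrite mul0r add0r lead_coefC => /eqP ->.
  by rewrite polyC1 rmorph1 hornerC place1.
rewrite lead_coefDl ?size_mul ?polyX_eq0 // ?size_polyX ?size_polyC; last first.
  by rewrite addn2 /= (leq_ltn_trans (leq_b1 _)) // ltnS size_poly_gt0.
rewrite lead_coefM lead_coefX mulr1 => /IH vp.
rewrite rmorphD rmorphM /= map_polyX map_polyC /= !hornerE.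
set s := (_.[z] * z)%R; have vs : v s < 0%:E.
  rewrite (placeM v_place).
  case: (v z) (v _.[z]) vz vp => [a| |] [c'| |] //.
  rewrite !lte_fin !lee_fin => a0 c0; suff: (c' + a < 0)%R by [].
  lia.
rewrite leNgt; apply/negP => vpos.
have := placeD v_place (s + phi c)%R (phi (- c)).
rewrite rmorphN addrK => le.
have : 0%:E <= v s.
  apply: le_trans le; rewrite le_min (ltW vpos) /= -rmorphN; exact: v_ge0.
by rewrite leNgt vs.
Qed.

Lemma place_integral_ge0 (z : L) : O z -> 0%:E <= v z.
Proof.
move=> [p mp /eqP pz]; rewrite leNgt; apply/negP => /place_monic_horner /(_ mp).
by rewrite pz (proj2 (place_eq_oo v_place 0%R)).
Qed.

Lemma place_unit (z : L) k :
  O z -> (0 < k)%N -> 0%:E < v z -> v (1 - z ^+ k)%R = 0%:E.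
Proof.
case: k => // k zO _ vz.
have zkO : O (z ^+ k)%R by apply: integral_exp.
apply/eqP; rewrite eq_le andbC.
rewrite place_integral_ge0 /=; last first.
  by apply: integral_sub; [exact: integral1 | exact: integral_exp].
rewrite leNgt; apply/negP => vpos.
have := placeD v_place (1 - z ^+ k.+1)%R (z ^+ k.+1)%R.
rewrite subrK place1 leNgt lt_min vpos exprS (placeM v_place).
by rewrite lte_paddr // place_integral_ge0.
Qed.


End Places.

Section Unramified.

Variables (K : finFieldType) (L : fieldExtType {fraction {poly K}}).
Local Notation phi := (polyL L).
Local Notation O := (integralOver phi).

(** Divide [z - z^(2^d) = P w] by the unit [1 - z^(2^d - 1)] at [v]: the
    valuation of [z] is that of [P w], so [w] has smaller valuation than [z] with
    the same residue modulo [e].  By descent [e] divides every valuation of an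
    integral element; the value 1 is taken, and clearing the denominator changes
    it by a multiple of [e]. *)
Lemma reduced_unramified n (b : n.-tuple L) P (v : L -> \bar int) e :
    2%N \in [pchar K] -> integral_basis b -> basis_of {:L} b ->
    P != 0 -> reduced_at L P ->
    is_place v -> lies_above v P -> ramification_index v P e ->
  e = 1%N.
Proof.
move=> char2 bI bb P0 red v_place vabove [e0 ve].
have v_fin a : a != 0 -> exists m : nat, v (phi a) = (Posz (e * m))%:E.
  by move=> a0; rewrite ve /vP (negPf a0); eexists; rewrite -EFinM -PoszM.
have v_ge0 a : (0%:E <= v (phi a))%E.
  have [->|/v_fin[m ->]] := eqVneq a 0; last by rewrite lee_fin.
  by rewrite rmorph0 (proj2 (place_eq_oo v_place 0)).
have [m vPE] := v_fin P P0.
have m0 : (0 < e * m)%N by move: vabove; rewrite /lies_above vPE lte_fin.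
have descent k (z : L) : O z -> v z = (Posz k)%:E -> (e %| k)%N.
  elim/ltn_ind: k z => k IH z zO vz.
  have [->|k0] := posnP k; first exact: dvdn0.
  have vz0 : (0%:E < v z)%E by rewrite vz lte_fin.
  have [d [w [d0 wO zw]]] := reduced_frobenius char2 bI P0 red zO.
  have : v (z * (1 - z ^+ (2 ^ d).-1)) = v (phi P * w).
    by rewrite -zw mulrBr mulr1 -exprS prednK ?expn_gt0.
  rewrite !(placeM v_place) vPE (place_unit v_place v_ge0 zO _ vz0); last first.
    have : (2 ^ 0 < 2 ^ d)%N by rewrite ltn_exp2l.
    by rewrite expn0; case: (2 ^ d)%N => [|[]].
  have := place_integral_ge0 v_place v_ge0 wO.
  rewrite vz; case vw: (v w) => [[x|x]| |] //= _ [] kE.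
  have {}kE : (k = e * m + x)%N by lia.
  rewrite kE dvdn_add ?dvdn_mulr // (IH x _ w) //.
  by rewrite kE -{1}[x]add0n ltn_add2r.
have [z0 vz0] := place_normalized v_place.
have [bO _ _] := bI.
have [d d0 dO] := clear_denominators z0 bb bO.
have [k vk] := v_fin d d0.
have := descent (e * k + 1)%N _ dO; rewrite (placeM v_place) vk vz0.
by rewrite dvdn_addr ?dvdn_mulr // dvdn1 => /(_ erefl)/eqP.
Qed.

End Unramified.

(** * Divisibility by the index *)

Lemma monic_irreducible_divisor (K : finFieldType) (p : {poly K}) :
  (1 < size p)%N -> exists2 P, finite_place P & P %| p.
Proof.
have [n] := ubnP (size p); elim: n p => // n IH p; rewrite ltnS => le_pn p1.
have [/irreducibleP irr|] := boolP (irreducibleb p).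
  have c0 : (lead_coef p)^-1 != 0 by rewrite invr_eq0 lead_coef_eq0 irredp_neq0.
  exists ((lead_coef p)^-1 *: p); last by rewrite dvdpZl.
  split; first by rewrite monicE lead_coefZ mulVf // -invr_eq0.
  case: irr => _ irr; split=> [|q q1]; first by rewrite size_scale.
  rewrite dvdpZr // => /(irr _ q1)/eqp_trans; apply.
  by rewrite eqp_sym eqp_scale.
rewrite /irreducibleb p1 negb_forall => /existsP[q].
rewrite negb_imply -ltnNge => /andP[qp q1].
have [|//|P Pp Pq] := IH q.
  apply: leq_trans le_pn; apply: leq_ltn_trans (size_npoly q) _.
  by rewrite ltn_predL ltnW.
by exists P => //; apply: dvdp_trans Pq _; rewrite Pdiv.Idomain.dvdpE.
Qed.

Section Divisibility.

Variables (K : finFieldType) (A B I J G U : {poly K}).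
Hypothesis B0 : B != 0.
Hypothesis Bcubefree : cubefree B.
Hypothesis BIJ : B = I * J.
Hypothesis dvdJ : forall P, finite_place P -> P %| B -> P %| J.

(** A prime whose square divides [I] divides [B], hence [J], so its cube divides
    [I J = B]. *)
Lemma index_squarefree (P : {poly K}) : finite_place P -> ~~ (P ^+ 2 %| I).
Proof.
move=> Pp; apply/negP => P2.
have PJ : P %| J.
  by apply: dvdJ; rewrite // BIJ dvdp_mulr // (dvdp_trans _ P2) // dvdp_exp.
have : P ^+ 3 %| B by rewrite BIJ exprSr dvdp_mul.
by move/Bcubefree; case: Pp => _ [P1 _]; rewrite leqNgt P1.
Qed.

Lemma index_factor_coprime (D E : {poly K}) : I = D * E -> coprimep D E.
Proof.
move=> IDE; have /norP[D0 E0] : ~~ ((D == 0) || (E == 0)).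
  by rewrite -mulf_eq0 -IDE; apply: contraNneq B0 => I0; rewrite BIJ I0 mul0r.
apply/negPn/negP; rewrite /coprimep neq_ltn ltnS size_poly_leq0 gcdp_eq0.
rewrite (negPf D0) /= => /monic_irreducible_divisor[P Pp].
rewrite dvdp_gcd => /andP[PD PE]; have := index_squarefree Pp.
by rewrite IDE expr2 dvdp_mul.
Qed.

(** [I] divides [J]: a prime dividing [I / gcd(I, J)] divides [J] too, so it
    divides [I] twice. *)
Lemma index_sqr_dvd : I ^+ 2 %| B.
Proof.
rewrite expr2 BIJ dvdp_mul //.
have DI := dvdp_gcdl I J; have DJ := dvdp_gcdr I J.
have IE := divpK DI.
have [E1|E1] := leqP (size (I %/ gcdp I J)) 1; last first.
  have [P Pp PE] := monic_irreducible_divisor E1.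
  have PI : P %| I by rewrite -IE dvdp_mulr.
  have PJ : P %| J by apply: dvdJ; rewrite // BIJ dvdp_mulr.
  have := index_squarefree Pp.
  by rewrite -IE expr2 dvdp_mul // dvdp_gcd PI.
apply: dvdp_trans DJ; rewrite -{1}IE [_ %/ _]size1_polyC //.
rewrite mul_polyC dvdpZl //; apply: contraNneq B0 => c0.
by rewrite BIJ -IE [_ %/ _]size1_polyC // c0 !mul0r.
Qed.

Hypothesis hG : G %= gcdp I A.
Hypothesis hUA : (I %/ G) ^+ 2 %| U ^+ 2 - A.
Hypothesis hUG : G %| U.

(** These are the coefficients found in [cubic_charpoly_sqr].  [G] divides [A], and
    [G (I / G)^2] divides [U^2 - A] because [G] and [I / G] are coprime. *)
Lemma charpoly_coef_dvd :
  (I ^+ 2 %| A * (U ^+ 2 - A) + U * B) /\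
  (I ^+ 3 %| B * (U * (U ^+ 2 - A) + B)).
Proof.
have GI : G %| I by rewrite (eqp_dvdl _ hG) dvdp_gcdl.
have GA : G %| A by rewrite (eqp_dvdl _ hG) dvdp_gcdr.
have IE : I = G * (I %/ G) by rewrite mulrC divpK.
have GH : G * (I %/ G) ^+ 2 %| U ^+ 2 - A.
  rewrite Gauss_dvdp; last by rewrite coprimep_expr // index_factor_coprime.
  by rewrite hUA andbT dvdp_sub // expr2 dvdp_mulr.
have I2B := index_sqr_dvd; split.
  rewrite dvdp_add //; last by rewrite dvdp_mull.
  by rewrite {1}IE exprMn expr2 -mulrA dvdp_mul.
rewrite exprSr dvdp_mul // dvdp_add //; last by rewrite BIJ dvdp_mulr.
rewrite {1}IE dvdp_mul //; apply: dvdp_trans hUA; exact: dvdp_exp.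
Qed.

End Divisibility.

(** * Recognizing integral bases by their discriminant *)

Section DiscCriterion.

Variables (K : finFieldType) (L : fieldExtType {fraction {poly K}}).
Local Notation phi := (polyL L).
Local Notation O := (integralOver phi).

Variables (n : nat) (b t : n.-tuple L).

(** The matrix [C] expressing [t] on [b] is polynomial, and
    [disc t = (det C)^2 disc b]; so [det C] is a unit and [b] can be expressed on
    [t]. *)
Lemma integral_basis_disc : integral_basis b -> (forall j, O (tnth t j)) ->
  fdisc b != 0 -> fdisc t = fdisc b -> integral_basis t.
Proof.
move=> [bO bspan bfree] tO b0 tb.
have [c cE] := fin_all_exists (fun j => bspan _ (tO j)).
pose C := \matrix_(i, j) c j i.
pose comb (u : n.-tuple L) (d : 'cV_n) := \sum_i phi (d i 0) * tnth u i.
have combE d : comb t d = comb b (C *m d).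
  rewrite /comb; under eq_bigr do rewrite cE mulr_sumr.
  rewrite exchange_big; apply: eq_bigr => i _; rewrite mxE rmorph_sum mulr_suml.
  by apply: eq_bigr => j _; rewrite mxE mulrA -rmorphM [c _ _ * _]mulrC.
have detC : \det C ^+ 2 = 1.
  have tC j : tnth t j = \sum_i map_mx (@FracField.tofrac _) C i j *: tnth b i.
    by rewrite cE; apply: eq_bigr => i _; rewrite !mxE polyL_scale.
  apply/eqP; rewrite -tofrac_eq tofracXn -det_map_mx; apply/eqP/(mulIf b0).
  by rewrite mul1r -[RHS]tb; exact: esym (fdisc_change tC).
pose M := \det C *: \adj C.
have CM : C *m M = 1%:M.
  by rewrite -scalemxAr mul_mx_adj scale_scalar_mx -expr2 detC.
have MC : M *m C = 1%:M.
  by rewrite -scalemxAl mul_adj_mx scale_scalar_mx -expr2 detC.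
split=> // [z zO|d d0].
  have [d ->] := bspan _ zO; exists (fun i => (M *m \col_j d j) i 0).
  rewrite -[RHS]/(comb t _) combE mulmxA CM mul1mx.
  by apply: eq_bigr => i _; rewrite mxE.
have : comb t (\col_j d j) = 0.
  by rewrite -d0; apply: eq_bigr => i _; rewrite mxE.
rewrite combE => /bfree Cd i.
have -> : d i = (\col_j d j : 'cV_n) i 0 by rewrite mxE.
rewrite -[\col_j _]mul1mx -MC -mulmxA.
suff -> : C *m \col_j d j = 0 by rewrite mulmx0 mxE.
by apply/colP=> j; rewrite Cd mxE.
Qed.

End DiscCriterion.

(** * Cubic polynomials *)

(** If [y1, y2, y3] are the roots of [T^3 - a T + b] then, in characteristic 2, the
    elements [yi (yi + u)] have sum 0, second elementary symmetric function
    [a (u^2 - a) + u b] and product [b (u (u^2 - a) + b)]. *)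
Lemma cubic_charpoly_sqr (R : comNzRingType) (y a b u : R) :
  2%N \in [pchar R] ->
  y ^+ 3 = a * y + b ->
  (y ^+ 2 + u * y) ^+ 3 + (a * (u ^+ 2 - a) + u * b) * (y ^+ 2 + u * y)
    + b * (u * (u ^+ 2 - a) + b) = 0.
Proof.
move=> char2 y3.
have -> : (y ^+ 2 + u * y) ^+ 3 = y ^+ 3 * (y ^+ 3 + 3 * u * y ^+ 2
    + 3 * u ^+ 2 * y + u ^+ 3) by ring.
rewrite {1 2}y3.
(* 1 + 1 times one polynomial, plus a multiple of the cubic equation of y. *)
transitivity ((1 + 1) * ((2 * u * b + 2 * u ^+ 2 * a) * y ^+ 2
  + (a * b + u * a ^+ 2 + 2 * u ^+ 2 * b + u ^+ 3 * a) * y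
  + b ^+ 2 + u * a * b + u ^+ 3 * b)
  + 3 * a * u * (y ^+ 3 - a * y - b)); first by ring.
by rewrite y3 (addrr_pchar2 char2); ring.
Qed.

Section CubicPolynomial.

Variables (R : comNzRingType) (a b : R).
Let f := 'X^3 - a%:P * 'X + b%:P.

Let fE : f = ('X^2 - a%:P) * 'X + b%:P.
Proof. by rewrite /f; ring. Qed.

Lemma size_cubic : size f = 4%N.
Proof.
by rewrite fE size_MXaddC size_XnsubC // -size_poly_eq0 size_XnsubC.
Qed.

Lemma monic_cubic : f \is monic.
Proof.
rewrite monicE lead_coefE size_cubic /f mulrC !coefE /=.
by rewrite mul0r subr0 addr0.
Qed.

Lemma horner_map_cubic (S : comNzRingType) (g : {rmorphism R -> S}) z :
  (map_poly g f).[z] = z ^+ 3 - g a * z + g b.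
Proof.
rewrite rmorphD rmorphB /= map_polyXn rmorphM /= map_polyX !map_polyC.
by rewrite !hornerE.
Qed.

End CubicPolynomial.

Lemma cubic_power_basis (F : fieldType) (L : fieldExtType F) (y : L) (a b : F) :
    irreducible_poly ('X^3 - a%:P * 'X + b%:P) ->
    y ^+ 3 - a%:A * y + b%:A = 0 -> <<1; y>>%VS = {:L}%VS ->
  basis_of {:L} [tuple 1; y; y ^+ 2].
Proof.
move=> irr y0 gen; have /polyOver1P[m mE] := minPolyOver 1 y.
have sm : size m = (adjoin_degree 1 y).+1.
  by rewrite -size_minPoly mE size_map_poly.
have n3 : adjoin_degree 1 y = 3%N.
  suff m4 : size m = 4%N by apply/eqP; rewrite -eqSS -sm m4.
  rewrite -(size_cubic a b); apply: eqp_size.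
  case: irr => _; apply; first by rewrite sm.
  rewrite -(dvdp_map (in_alg L)) -mE; apply: minPoly_dvdp.
    exact: alg_polyOver.
  by rewrite /root horner_map_cubic /= y0.
rewrite basisEdim -gen dim_Fadjoin n3 dimv1 andbT.
apply/subvP=> v /Fadjoin_poly_eq <-.
rewrite (@horner_coef_wide _ 3%N); last by rewrite -n3 size_Fadjoin_poly.
apply: memv_suml => i _.
have /polyOverP/(_ i)/vlineP[k ->] := Fadjoin_polyOver 1 y v.
rewrite mulr_algl memvZ // memv_span //.
by case: i => [[|[|[|]]]] //= _; rewrite !inE ?eqxx ?orbT.
Qed.

(** * The primes dividing B divide the discriminant *)

Section Cubic.

Variables (K : finFieldType) (char2 : 2%N \in [pchar K]).
Variables (L : fieldExtType {fraction {poly K}}) (y : L) (A B : {poly K}).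
Hypothesis std : standard_form A B y.
Local Notation phi := (polyL L).
Local Notation O := (integralOver phi).
Local Notation tofrac := FracField.tofrac.

Local Notation e := [tuple 1; y; y ^+ 2].

Lemma pchar_frac : 2%N \in [pchar {fraction {poly K}}].
Proof.
apply: (rmorph_pchar (@FracField.tofrac {poly K})).
exact: (rmorph_pchar (@polyC K)).
Qed.

Lemma pchar_ext : 2%N \in [pchar L].
Proof. by rewrite pchar_lalg pchar_frac. Qed.

Lemma cubic_eq : y ^+ 3 = phi A * y + phi B.
Proof.
have /eqP := std_root std.
by rewrite addr_eq0 subr_eq (oppr_pchar2 pchar_ext) addrC => /eqP.
Qed.

(** Otherwise [T] divides the irreducible polynomial [T^3 - A T]. *)
Lemma B_neq0 : B != 0.
Proof.
apply/eqP=> B0; have [_] := std_irreducible std.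
move/(_ 'X); rewrite size_polyX B0 tofrac0 addr0 => /(_ isT).
have -> : 'X^3 - (tofrac A)%:P * 'X = 'X * ('X^2 - (tofrac A)%:P) by ring.
rewrite dvdp_mulr // => /(_ isT)/eqp_size; rewrite size_polyX.
have -> : 'X * ('X^2 - (tofrac A)%:P) = 'X^3 - (tofrac A)%:P * 'X + 0%:P.
  by ring.
by rewrite size_cubic.
Qed.

Lemma power_basis : basis_of {:L} e.
Proof.
exact: cubic_power_basis (std_irreducible std) (std_root std)
  (std_generator std).
Qed.

Let y3 : y ^+ 3 = tofrac A *: y + tofrac B *: 1.
Proof. by rewrite cubic_eq !polyL_scale mulr1. Qed.

Lemma power_disc : fdisc e = tofrac B ^+ 2.
Proof. exact: fdisc_power pchar_frac y3 power_basis. Qed.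

Let trace_sqr := ftrace_sqr pchar_frac y3 power_basis.

Lemma integral_cubic_root (z : L) a b :
  z ^+ 3 - phi a * z + phi b = 0 -> O z.
Proof.
move=> z0; exists ('X^3 - a%:P * 'X + b%:P); first exact: monic_cubic.
by rewrite /root horner_map_cubic z0.
Qed.

Lemma integral_gen : O y.
Proof. exact: integral_cubic_root (std_root std). Qed.

(** The discriminant of [b] is a polynomial, being a determinant of traces of
    integral elements, so [B^2 = I^2 Delta] makes [I^2] divide [B^2]. *)
Lemma index_factor I : is_index y I ->
  exists J (b : 3.-tuple L), [/\ B = I * J, integral_basis b,
    basis_of {:L} b & fdisc b = tofrac (J ^+ 2)].
Proof.
rewrite /is_index /is_field_disc (size_basis power_basis).
move=> [_ [b bI ->] dE]; have yO := integral_gen.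
have eO i : O (tnth e i).
  have := mem_tnth i e; rewrite !inE => /or3P[] /eqP->.
  - exact: integral1.
  - exact: yO.
  - exact: (integral_exp 2 yO).
have bb := integral_basis_basis power_basis eO bI.
have [bO _ _] := bI; have [T [_ TE]] := disc_integral bI bb bO.
have : tofrac B ^+ 2 = tofrac I ^+ 2 * tofrac (\det T).
  by rewrite -power_disc -TE.
rewrite -!tofracXn -tofracM => /eqP; rewrite tofrac_eq => /eqP BE.
have IB : I %| B by rewrite -(@dvdp_pexp2r _ _ _ 2) // BE dvdp_mulr.
exists (B %/ I), b; split=> //; first by rewrite mulrC divpK.
have I0 : I != 0 by apply: contraNneq B_neq0 => I0; rewrite -dvd0p -I0.
rewrite TE; move: BE; rewrite -{1}(divpK IB) exprMn mulrC.
by move/(mulfI (expf_neq0 2 I0)) => <-.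
Qed.

Hypothesis Bcubefree : cubefree B.
Hypothesis sig : forall P : {poly K}, finite_place P ->
  (3%:E * vP P A < 2%:E * vP P B)%E -> has_signature L P [:: (1, 1); (2, 1)]%N.

(** If [P] does not divide [J], then it is unramified in the sense that [O / P O]
    is reduced.  When [P] divides [A] this contradicts [y^3 = A y + B], and
    otherwise it contradicts the ramification index 2 in the signature. *)
Lemma prime_dvd_cofactor I J (b : 3.-tuple L) P :
    B = I * J -> integral_basis b -> basis_of {:L} b ->
    fdisc b = tofrac (J ^+ 2) ->
  finite_place P -> P %| B -> P %| J.
Proof.
move=> BIJ bI bb bD Pp PB; apply/negPn/negP => PJ.
have [_ irrP] := Pp; have P0 := irredp_neq0 irrP; have [P1 _] := irrP.
have red : reduced_at L P.
  apply: (reduced_of_disc bI bb trace_sqr irrP bD).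
  rewrite -irreducible_poly_coprime // coprimep_expr //.
  by rewrite irreducible_poly_coprime.
have [PA|PA] := boolP (P %| A); last first.
  have A0 : A != 0 by apply: contraNneq PA => ->; apply: dvdp0.
  have sP : (3%:E * vP P A < 2%:E * vP P B)%E.
    rewrite vP_eq0 //; have := vP_gt0 Pp PB; case: (vP P B) => [k| |] //.
    by rewrite !lte_fin => k0; suff: (3 * 0 < 2 * k)%R by []; lia.
  have [v [/(_ 1) [v1 above1 ram _] _ _]] := sig Pp sP.
  by have := reduced_unramified char2 bI bb P0 red v1 above1 ram.
have yO := integral_gen.
pose w := phi (A %/ P) * y + phi (B %/ P).
have wO : O w.
  by apply: integral_add; [apply: integral_mul => // |]; apply: integral_id.
have y3w : y ^+ 3 = phi P * w.
  by rewrite cubic_eq mulrDr mulrA -!rmorphM ![P * _]mulrC !divpK.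
have [w1 w1O y2] : exists2 w', O w' & y ^+ 2 = phi P * w'.
  apply: (red _ (y * w) (integral_exp 2 yO) (integral_mul yO wO)).
  by rewrite mulrCA -y3w -exprS -exprM.
have [w2 w2O yE] := red _ _ yO w1O y2.
have [s sE] := trace_integral bI bb (integral_exp 3 w2O).
have : P ^+ 3 %| B.
  suff -> : B = P ^+ 3 * s by apply: dvdp_mulr.
  apply/eqP; rewrite -tofrac_eq; apply/eqP; rewrite tofracM -sE -ftraceZ.
  rewrite polyL_scale rmorphXn -exprMn -yE y3 ftraceD !ftraceZ.
  have [-> -> _] := ftrace_power pchar_frac y3 power_basis.
  by rewrite mulr0 add0r mulr1.
by move/Bcubefree; rewrite leqNgt P1.
Qed.

End Cubic.

(** * The integral basis *)

Theorem theorem2p3p5 (K : finFieldType) (char2 : 2%N \in [pchar K])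
    (L : fieldExtType {fraction {poly K}}) (y : L) (A B : {poly K})
    (std : standard_form A B y)
    (Bcubefree : cubefree B)
    (sig : forall P : {poly K}, finite_place P ->
       (3%:E * vP P A < 2%:E * vP P B)%E ->
       has_signature L P [:: (1, 1); (2, 1)]%N)
    (I : {poly K}) (hI : is_index y I)
    (G : {poly K}) (hG : G %= gcdp I A)
    (U V W : {poly K})
    (hUA : (I %/ G) ^+ 2 %| U ^+ 2 - A)
    (hUG : G %| U)
    (hVI : I %| V) :
  integral_basis
    [tuple 1; y + polyL L W; (y ^+ 2 + polyL L U * y + polyL L V) / polyL L I].
Proof.
have [J [b [BIJ bI bb bD]]] := index_factor char2 std hI.
have B0 := B_neq0 std.
have PJ := prime_dvd_cofactor char2 std Bcubefree sig BIJ bI bb bD.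
have [d2 d3] := charpoly_coef_dvd B0 Bcubefree BIJ PJ hG hUA hUG.
have [I0 J0] : I != 0 /\ J != 0 by apply/norP; rewrite -mulf_eq0 -BIJ.
have pI0 : polyL L I != 0 by rewrite polyL_eq0.
have zO : integralOver (polyL L) ((y ^+ 2 + polyL L U * y) / polyL L I).
  have := cubic_charpoly_sqr (polyL L U) (pchar_ext char2 L)
    (cubic_eq char2 std).
  set z := y ^+ 2 + _.
  rewrite -!rmorphXn -!rmorphB -!rmorphM -!rmorphD -!rmorphM.
  rewrite -(divpK d2) -(divpK d3).
  set q2 := _ %/ _; set q3 := _ %/ _ => zE.
  apply: (@integral_cubic_root _ _ _ (- q2) q3).
  apply: (mulfI (expf_neq0 3 pI0)); rewrite mulr0 -zE rmorphN.
  rewrite (rmorphM _ q2) (rmorphM _ q3) !rmorphXn.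
  by field.
apply: (integral_basis_disc bI) => [j||].
- have := mem_tnth j [tuple 1; y + polyL L W;
    (y ^+ 2 + polyL L U * y + polyL L V) / polyL L I].
  rewrite !inE => /or3P[] /eqP->; first exact: integral1.
    by apply: integral_add; [exact: integral_gen std | exact: integral_id].
  rewrite mulrDl; apply: integral_add => //.
  by rewrite -(divpK hVI) rmorphM mulfK //; apply: integral_id.
- by rewrite bD tofrac_eq0 expf_neq0.
pose tf := @FracField.tofrac {poly K}.
(* The columns of C are the coordinates of the new family on 1, y, y^2. *)
pose C : 'M[{fraction {poly K}}]_3 := \matrix_(i, j)
  nth 0 (nth [::] [:: [:: 1; tf W; tf V / tf I];
                      [:: 0; 1; tf U / tf I];
                      [:: 0; 0; (tf I)^-1]] i) j.
rewrite (@fdisc_change _ _ _ [tuple 1; y; y ^+ 2] _ C) => [|j].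
  rewrite -det_tr det_trig; last first.
    by apply/is_trig_mxP => [[[|[|[|]]]] // ? [[|[|[|]]]] // ? _]; rewrite !mxE.
  rewrite !big_ord_recl big_ord0 !mxE /= !mul1r mulr1 bD.
  rewrite (power_disc char2 std).
  by rewrite BIJ (tofracM I J) tofracXn -exprMn mulKf ?tofrac_eq0.
rewrite !big_ord_recl big_ord0 !mxE.
have divI z : (tf I)^-1 *: z = z / polyL L I.
  by rewrite -mulr_algl -[_%:A]/(in_alg L _) fmorphV mulrC.
case: j => [[|[|[|]]] //= j3]; rewrite /tnth /= ?scale0r ?scale1r !addr0 //.
  by rewrite addrC.
rewrite -!(scalerA _ (tf I)^-1) !divI !polyL_scale.
by field.
Qed.
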